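(* Let $\emptyset\neq H\subset\mathbb R^n$, let $A\colon[0,\infty)\to\mathbb R^{n\times n}$ and $f\colon[0,\infty)\times\mathbb R^n\to\mathbb R^n$ be continuous, and suppose that the linear equation $x'=A(t)x$ has an exponential dichotomy on $[0,\infty)$ with constants $N,\lambda>0$. Suppose there exist $\delta,L>0$ such that $$|f(t,x_1)-f(t,x_2)|\le L|x_1-x_2|\quad\text{for all }t\ge0\text{ and }x_1,x_2\in\mathcal N_\delta(H).$$ If $L<\dfrac{\lambda}{2N}$, then the equation $x'=A(t)x+f(t,x)$ has the conditional Lipschitz shadowing property in $H$.
   Context: $|\cdot|$ is a fixed norm on $\mathbb R^n$ and also denotes the induced matrix norm on $\mathbb R^{n\times n}$. For $x\in\mathbb R^n$ and $\delta>0$, $B_\delta(x)=\{y\in\mathbb R^n:|y-x|\le\delta\}$, and for $\emptyset\ne H\subset\mathbb R^n$, $\mathcal N_\delta(H)=\bigcup_{x\in H}B_\delta(x)$. For a continuous $g\colon[0,\infty)\times\mathbb R^n\to\mathbb R^n$ consider $x'=g(t,x)$. Given $\tau\in(0,\infty]$, a pseudosolution of this equation on $[0,\tau)$ is a continuously differentiable $y\colon[0,\tau)\to\mathbb R^n$ such that $\sigma_y:=\sup_{0\le t<\tau}|y'(t)-g(t,y(t))|<\infty$; $\sigma_y$ is its maximum error. For $\emptyset\ne H\subset\mathbb R^n$, the equation has the conditional Lipschitz shadowing property in $H$ if there exist $\varepsilon_0>0$ and $\kappa>0$ such that: whenever $0<\varepsilon\le\varepsilon_0$ and $y$ is a pseudosolution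 on $[0,\tau)$ for some $\tau\in(0,\infty]$ with $\sigma_y\le\varepsilon$ and $y(t)\in H$ for all $t\in[0,\tau)$, there is a solution $x$ of the equation defined on $[0,\tau)$ with $\sup_{0\le t<\tau}|x(t)-y(t)|\le\kappa\varepsilon$. Let $T(t,s)=\Phi(t)\Phi(s)^{-1}$ be the transition matrix of $x'=A(t)x$ ($\Phi$ a fundamental matrix). This equation has an exponential dichotomy on $[0,\infty)$ if there exist projections $P(t)\in\mathbb R^{n\times n}$, $t\ge0$, and constants $N,\lambda>0$ with $P(t)T(t,s)=T(t,s)P(s)$ for all $t,s\ge0$, $|T(t,s)P(s)|\le Ne^{-\lambda(t-s)}$ for $t\ge s\ge0$, and $|T(t,s)(I-P(s))|\le Ne^{-\lambda(s-t)}$ for $0\le t\le s$. *)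

(* Defs.v *)
From HB Require Import structures.
From mathcomp Require Import all_boot all_order all_algebra.
From mathcomp Require Import all_classical all_reals all_analysis.
Set Implicit Arguments. Unset Strict Implicit. Unset Printing Implicit Defensive.
Import Order.TTheory GRing.Theory Num.Theory.
Import numFieldNormedType.Exports.
Local Open Scope classical_set_scope.
Local Open Scope ring_scope.

Section Defs.
Variables (R : realType) (n : nat).

Definition is_norm (nrm : 'cV[R]_n -> R) : Prop :=
  (forall x, 0 <= nrm x) /\ (forall x, nrm x = 0 -> x = 0) /\
  (forall (a : R) x, nrm (a *: x) = `|a| * nrm x) /\
  (forall x y, nrm (x + y) <= nrm x + nrm y).

Definition opnorm (nrm : 'cV[R]_n -> R) (M : 'M[R]_n) : R :=
  sup [set nrm (M *m x) | x in [set x | nrm x <= 1]].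

Definition Iv (tau : \bar R) : set R := [set t | 0 <= t /\ (t%:E < tau)%E].

(* dy is the derivative of y on the interval [0,tau) (one-sided at 0) *)
Definition deriv_on (p q : nat) (tau : \bar R) (y dy : R -> 'M[R]_(p, q)) : Prop :=
  forall t, Iv tau t ->
    (fun s => (s - t)^-1 *: (y s - y t)) @ within [set s | Iv tau s /\ s != t] (nbhs t)
      --> dy t.

Definition C1_on (tau : \bar R) (y dy : R -> 'cV[R]_n) : Prop :=
  deriv_on tau y dy /\ {within Iv tau, continuous dy}.

Definition pseudosol (nrm : 'cV[R]_n -> R) (g : R -> 'cV[R]_n -> 'cV[R]_n)
  (tau : \bar R) (y dy : R -> 'cV[R]_n) (eps : R) : Prop :=
  C1_on tau y dy /\ forall t, Iv tau t -> nrm (dy t - g t (y t)) <= eps.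

Definition solution (g : R -> 'cV[R]_n -> 'cV[R]_n) (tau : \bar R) (x : R -> 'cV[R]_n) : Prop :=
  exists dx, deriv_on tau x dx /\ forall t, Iv tau t -> dx t = g t (x t).

Definition cond_lip_shadowing (nrm : 'cV[R]_n -> R) (g : R -> 'cV[R]_n -> 'cV[R]_n)
  (H : set 'cV[R]_n) : Prop :=
  exists eps0 : R, exists kappa : R, 0 < eps0 /\ 0 < kappa /\
    forall eps : R, 0 < eps -> eps <= eps0 ->
    forall (tau : \bar R), (0 < tau)%E ->
    forall y dy, pseudosol nrm g tau y dy eps ->
      (forall t, Iv tau t -> H (y t)) ->
      exists x, solution g tau x /\
        forall t, Iv tau t -> nrm (x t - y t) <= kappa * eps.

Definition fundamental (A Phi : R -> 'M[R]_n) : Prop :=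
  (forall t, 0 <= t -> Phi t \in unitmx) /\
  exists dPhi, deriv_on +oo%E Phi dPhi /\ forall t, 0 <= t -> dPhi t = A t *m Phi t.

Definition transition (Phi : R -> 'M[R]_n) (t s : R) : 'M[R]_n :=
  Phi t *m invmx (Phi s).

Definition exp_dichotomy (nrm : 'cV[R]_n -> R) (A : R -> 'M[R]_n) (N lam : R) : Prop :=
  0 < N /\ 0 < lam /\
  exists Phi, fundamental A Phi /\
  exists P : R -> 'M[R]_n,
    (forall t, 0 <= t -> P t *m P t = P t) /\
    (forall t s, 0 <= t -> 0 <= s -> P t *m transition Phi t s = transition Phi t s *m P s) /\
    (forall t s, 0 <= s -> s <= t ->
       opnorm nrm (transition Phi t s *m P s) <= N * expR (- lam * (t - s))) /\
    (forall t s, 0 <= t -> t <= s ->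
       opnorm nrm (transition Phi t s *m (1%:M - P s)) <= N * expR (- lam * (s - t))).

Definition nbhd_set (nrm : 'cV[R]_n -> R) (delta : R) (H : set 'cV[R]_n) : set 'cV[R]_n :=
  [set y | exists2 x, H x & nrm (y - x) <= delta].

End Defs.

(* Main.v *)
(** With [Phi] a fundamental matrix and [Q] the constant projection [Phi(0)^-1 P(0) Phi(0)],
    every bounded continuous [r] on [[0, tau)] gives a bounded solution of [z' = A z + r],
      [G r (t) = Phi(t) (int_0^t Q Phi^-1 r - int_t^tau (1 - Q) Phi^-1 r)],
    and the dichotomy yields [|G r| <= (2 N / lam) sup |r|].  If [y] is a pseudosolution, then
    [y + z] is a solution as soon as [z = G (f(., y + z) + A y - y')]; the right-hand side is a
    contraction with ratio [q = 2 N L / lam < 1] of the sup-norm ball of radius [kappa eps], where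
    [kappa = (2 N / lam) / (1 - q)].  The integrals are handled as antiderivatives, and all the
    estimates come from the mean value inequality [|v'| <= w' -> |v b - v a| <= w b - w a]. *)
Require Import Defs.
From HB Require Import structures.
From mathcomp Require Import all_boot all_order all_algebra.
From mathcomp Require Import all_classical all_reals all_analysis.
From mathcomp Require Import ring lra.
Import Order.TTheory GRing.Theory Num.Theory.
Import numFieldNormedType.Exports.
Local Open Scope classical_set_scope.
Local Open Scope ring_scope.

(** * Entrywise bounds for the sup norm of matrices *)

Section MatrixNorm.
Context {R : realType} {m n : nat}.
Implicit Types x : 'M[R]_(m, n).

Lemma ler_entry_norm x i j : `|x i j| <= `|x|.
Proof.
rewrite [leRHS]/Num.norm /= mx_normrE; apply/bigmax_geP; right.
by exists (i, j).
Qed.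

Lemma ler_mx_norm x c : 0 <= c -> (forall i j, `|x i j| <= c) -> `|x| <= c.
Proof.
move=> c0 h; rewrite [leLHS]/Num.norm /= mx_normrE; apply/bigmax_leP.
by split=> // -[i j] _; exact: h.
Qed.

End MatrixNorm.

Lemma normr_trmx {R : realType} {m n : nat} (x : 'M[R]_(m, n)) : `|x^T| = `|x|.
Proof.
suff le p q (y : 'M[R]_(p, q)) : `|y^T| <= `|y|.
  by apply/eqP; rewrite eq_le le -{1}(trmxK x) le.
by apply: ler_mx_norm => // i j; rewrite mxE; exact: ler_entry_norm.
Qed.


(** * Limits of matrix products, determinants and inverses *)

Section MatrixLimits.
Context {R : realType} {T : Type} {F : set_system T} {FF : Filter F}.

Lemma cvg_congr {U : topologicalType} (f g : T -> U) (l : U) :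
  (\forall x \near F, f x = g x) -> f x @[x --> F] --> l -> g x @[x --> F] --> l.
Proof.
move=> fg fl; apply: cvg_trans fl; apply: near_eq_cvg.
by apply: filterS fg => x.
Qed.

Lemma cvg_mxP {m n : nat} (g : T -> 'M[R]_(m, n)) (M : 'M[R]_(m, n)) :
  g x @[x --> F] --> M <-> forall i j, g x i j @[x --> F] --> M i j.
Proof.
split=> [gM i j|gM].
  exact: (continuous_cvg _ (@coord_continuous R m n i j M) gM).
apply/cvg_ballP => e e0.
have : \forall x \near F, forall i j, ball (M i j) e (g x i j).
  apply: filter_forall => i; apply: filter_forall => j.
  by move/cvg_ballP : (gM i j); apply.
by apply: filterS => x xM; split.
Qed.

Lemma cvg_mulmx {m n p : nat} (g : T -> 'M[R]_(m, n)) (h : T -> 'M[R]_(n, p))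
    (M : 'M[R]_(m, n)) (M' : 'M[R]_(n, p)) :
  g x @[x --> F] --> M -> h x @[x --> F] --> M' ->
  g x *m h x @[x --> F] --> M *m M'.
Proof.
move=> /cvg_mxP gM /cvg_mxP hM; apply/cvg_mxP => i j.
rewrite mxE (_ : (fun x => _) = fun x => \sum_k g x i k * h x k j).
  apply: cvg_big => [|k _]; first exact: add_continuous.
  exact: (cvgM (gM i k) (hM k j)).
by apply/funext => x; rewrite mxE.
Qed.

Lemma cvg_det {n : nat} (g : T -> 'M[R]_n) (M : 'M[R]_n) :
  g x @[x --> F] --> M -> \det (g x) @[x --> F] --> \det M.
Proof.
move=> /cvg_mxP gM; rewrite /determinant.
apply: cvg_big => [|s _]; first exact: add_continuous.
apply: cvgMl_tmp.
by apply: cvg_big => [|i _]; [exact: mul_continuous|exact: gM].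
Qed.

(** By Cramer's rule the inverse is the adjugate over the determinant. Both are polynomial in the
    entries, and the determinant stays nonzero near the limit. *)
Lemma cvg_invmx {n : nat} (g : T -> 'M[R]_n) (M : 'M[R]_n) :
  M \in unitmx -> g x @[x --> F] --> M -> invmx (g x) @[x --> F] --> invmx M.
Proof.
move=> uM gM.
have dM : \det M != 0 by rewrite -unitfE.
have dgM : \forall x \near F, \det (g x) != 0.
  exact: (cvgr_neq0 (\det M) (cvg_det _ _ gM) dM).
rewrite [in X in _ --> X]/invmx uM.
suff : (\det (g x))^-1 *: \adj (g x) @[x --> F] --> (\det M)^-1 *: \adj M.
  apply: cvg_trans; apply: near_eq_cvg; apply: filterS dgM => x dx.
  by rewrite /invmx unitmxE unitfE dx.
apply: cvgZ; first exact: (cvgV dM (cvg_det _ _ gM)).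
apply/cvg_mxP => i j; rewrite mxE.
rewrite (_ : (fun x => _) = fun x => cofactor (g x) j i); last first.
  by apply/funext => x; rewrite mxE.
apply: cvgMl_tmp.
apply: cvg_det; apply/cvg_mxP => k l; rewrite !mxE.
rewrite (_ : (fun x => _) = fun x => g x (lift j k) (lift i l)).
  by move/cvg_mxP : gM; apply.
by apply/funext => x; rewrite !mxE.
Qed.

End MatrixLimits.

(** * The half-open interval of times, bounded or not *)

Section Interval.
Context {R : realType}.
Implicit Types (tau : \bar R) (t : R).

Lemma Iv_le tau s t : 0 <= s -> s <= t -> Iv tau t -> Iv tau s.
Proof. by move=> s0 st [_ tt]; split => //; apply: le_lt_trans tt; rewrite lee_fin. Qed.

Lemma Iv_ge0 tau t : Iv tau t -> 0 <= t. Proof. by case. Qed.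

Lemma Iv_gt tau t : Iv tau t -> exists2 u, t < u & Iv tau u.
Proof.
move=> [t0]; case: tau => [r| |] //.
- rewrite lte_fin => tr; exists ((t + r) / 2); first by rewrite midf_lt.
  by split; [rewrite divr_ge0 // addr_ge0 // ltW // (le_lt_trans t0)|rewrite lte_fin midf_lt].
- by move=> _; exists (t + 1); [rewrite ltrDl|split; [rewrite addr_ge0|rewrite ltry]].
Qed.

(** Limits at [tau] are taken along such a sequence, which treats finite and infinite [tau]
    alike. *)
Lemma Iv_cofinal tau : (0 < tau)%E -> exists u : nat -> R,
  [/\ nondecreasing_seq u, forall k, Iv tau (u k) &
     forall t, Iv tau t -> \forall k \near \oo, t <= u k].
Proof.
case: tau => [r| |] //.
- rewrite lte_fin => r0; exists (fun k => r * (1 - k.+1%:R^-1)); split.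
  + move=> k l kl; rewrite ler_pM2l // lerD2l lerN2 lef_pV2 ?posrE //.
    by rewrite ler_nat.
  + move=> k; split.
      by rewrite mulr_ge0 ?(ltW r0) // subr_ge0 invf_le1 // ler1n.
    by rewrite lte_fin gtr_pMr // gtrBl invr_gt0.
  + move=> t [t0]; rewrite lte_fin => tr.
    have d0 : 0 < (r - t) / r by rewrite divr_gt0 // subr_gt0.
    have := near_infty_natSinv_lt (PosNum d0); apply: filterS => k /= /ltW.
    rewrite ler_pdivlMr // mulrC lerBrDr -lerBrDl => /le_trans; apply.
    by rewrite mulrBr mulr1.
- move=> _; exists (fun k => k%:R); split.
  + by move=> k l kl; rewrite ler_nat.
  + by move=> k; split; rewrite ?ltry.
  + by move=> t _; exact: nbhs_infty_ger.
Qed.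

End Interval.

(** * Calculus of derivatives on the interval *)

Section DerivOn.
Context {R : realType}.
Implicit Types (tau : \bar R).

Local Notation punct tau t := (within [set s | Iv tau s /\ s != t] (nbhs t)).

Lemma cvg_unpunct {p q : nat} tau (u : R -> 'M[R]_(p, q)) t :
  u s @[s --> punct tau t] --> u t -> u s @[s --> within (Iv tau) (nbhs t)] --> u t.
Proof.
move=> /cvgrPdist_lt h; apply/cvgrPdist_lt => e e0.
have := h _ e0; rewrite !near_withinE; apply: filterS => s hs Is.
have [->|st] := eqVneq s t; first by rewrite subrr normr0.
exact: hs.
Qed.

Lemma cvg_punct {p q : nat} tau (u : R -> 'M[R]_(p, q)) t (l : 'M[R]_(p, q)) :
  u s @[s --> within (Iv tau) (nbhs t)] --> l -> u s @[s --> punct tau t] --> l.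
Proof.
move=> h; apply: cvg_trans h; apply: cvg_app.
by apply: within_subset => s [].
Qed.

(** Off [t], [y s] is [s - t] times the difference quotient plus [y t], and the first term tends to
    0. *)
Lemma deriv_on_cvg {p q : nat} tau (y dy : R -> 'M[R]_(p, q)) t :
  deriv_on tau y dy -> Iv tau t ->
  y s @[s --> within (Iv tau) (nbhs t)] --> y t.
Proof.
move=> yd It; apply: cvg_unpunct.
have st : s - t @[s --> punct tau t] --> 0.
  have idt : s @[s --> punct tau t] --> t.
    by move=> P tP; apply: filterS tP => s.
  rewrite -(subrr t); exact: (cvgB idt (@cvg_cst _ t _ (punct tau t) _)).
pose proof (cvgD (cvgZ st (yd _ It)) (cvg_cst (y t))) as h; move: h.
rewrite scale0r add0r; apply: cvg_congr.
rewrite near_withinE; apply: filterE => s [_ nst].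
by rewrite /= scalerA divff ?subr_eq0 // scale1r subrK.
Qed.

Lemma deriv_on_within {p q : nat} tau (y dy : R -> 'M[R]_(p, q)) :
  deriv_on tau y dy -> {within Iv tau, continuous y}.
Proof. by move=> yd; apply/subspace_continuousP => t; exact: (deriv_on_cvg _ _ _ _ yd). Qed.

Lemma deriv_on_restrict {p q : nat} tau (y dy : R -> 'M[R]_(p, q)) :
  deriv_on +oo%E y dy -> deriv_on tau y dy.
Proof.
move=> yd t It; have Joo : Iv +oo%E t by split; rewrite ?ltry //; case: It.
apply: cvg_trans (yd _ Joo); apply: cvg_app; apply: within_subset => s [[s0 _] st].
by split=> //; split; rewrite ?ltry.
Qed.

Lemma deriv_onD {p q : nat} tau (y dy z dz : R -> 'M[R]_(p, q)) :
  deriv_on tau y dy -> deriv_on tau z dz ->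
  deriv_on tau (fun s => y s + z s) (fun s => dy s + dz s).
Proof.
move=> yd zd t It; pose proof (cvgD (yd _ It) (zd _ It)) as h; move: h.
apply: cvg_congr; apply: nearW => s /=.
by rewrite -scalerDr addrACA opprD.
Qed.

Lemma deriv_onN {p q : nat} tau (y dy : R -> 'M[R]_(p, q)) :
  deriv_on tau y dy -> deriv_on tau (fun s => - y s) (fun s => - dy s).
Proof.
move=> yd t It; pose proof (cvgN (yd _ It)) as h; move: h; apply: cvg_congr.
by apply: nearW => s /=; rewrite -scalerN opprB opprK [- y s + _]addrC.
Qed.

Lemma deriv_on_cst {p q : nat} tau (c : 'M[R]_(p, q)) :
  deriv_on tau (fun=> c) (fun=> 0).
Proof.
move=> t It; rewrite (_ : (fun s => _) = fun=> 0); first exact: cvg_cst.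
by apply/funext => s; rewrite subrr scaler0.
Qed.

Lemma deriv_on_eq {p q : nat} tau (y dy dz : R -> 'M[R]_(p, q)) :
  deriv_on tau y dy -> (forall t, Iv tau t -> dy t = dz t) -> deriv_on tau y dz.
Proof. by move=> yd e t It; rewrite -e //; exact: yd. Qed.

Lemma deriv_on_mulmx {m p q : nat} tau
    (X dX : R -> 'M[R]_(m, p)) (y dy : R -> 'M[R]_(p, q)) :
  deriv_on tau X dX -> deriv_on tau y dy ->
  deriv_on tau (fun s => X s *m y s) (fun s => dX s *m y s + X s *m dy s).
Proof.
move=> Xd yd t It.
pose proof (cvgD (cvg_mulmx _ _ _ _ (Xd _ It) (cvg_punct _ _ _ _ (deriv_on_cvg _ _ _ _ yd It)))
  (cvg_mulmx _ _ _ _ (cvg_cst (X t)) (yd _ It))) as h; move: h.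
apply: cvg_congr; apply: nearW => s /=.
rewrite -scalemxAl -scalemxAr -scalerDr mulmxBl mulmxBr; congr (_ *: _).
by rewrite addrA subrK.
Qed.

End DerivOn.

(** * Equivalence of an arbitrary norm with the sup norm, and the induced matrix norm *)

Section Norm.
Context {R : realType} {n : nat} {nrm : 'cV[R]_n -> R} (nrmP : is_norm nrm).

Lemma nrm_ge0 x : 0 <= nrm x. Proof. by case: nrmP. Qed.

Lemma nrm_eq0 x : nrm x = 0 -> x = 0. Proof. by case: nrmP => _ [h _]; exact: h. Qed.

Lemma nrmZ a x : nrm (a *: x) = `|a| * nrm x. Proof. by case: nrmP => _ [_ [h _]]; exact: h. Qed.

Lemma ler_nrmD x y : nrm (x + y) <= nrm x + nrm y.
Proof. by case: nrmP => _ [_ [_ h]]; exact: h. Qed.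

Lemma nrm0 : nrm 0 = 0. Proof. by rewrite -(scale0r (0 : 'cV[R]_n)) nrmZ normr0 mul0r. Qed.

Lemma nrmN x : nrm (- x) = nrm x.
Proof. by rewrite -scaleN1r nrmZ normrN1 mul1r. Qed.

Lemma nrm_distC x y : nrm (x - y) = nrm (y - x).
Proof. by rewrite -nrmN opprB. Qed.

Lemma ler_nrm_dist x y z : nrm (x - z) <= nrm (x - y) + nrm (y - z).
Proof. by rewrite (le_trans _ (ler_nrmD _ _)) // addrA subrK. Qed.

Lemma ler_nrm_sum (I : Type) (r : seq I) (P : pred I) (u : I -> 'cV[R]_n) :
  nrm (\sum_(i <- r | P i) u i) <= \sum_(i <- r | P i) nrm (u i).
Proof.
elim/big_ind2 : _ => //; first by rewrite nrm0.
by move=> x a y b xa yb; rewrite (le_trans (ler_nrmD _ _)) // lerD.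
Qed.

Lemma nrm_mulmx_ub (M : 'M[R]_n) :
  exists2 C, 0 < C & forall x, nrm (M *m x) <= C * `|x|.
Proof.
(* The summand 1 keeps the constant positive when every column vanishes. *)
exists (1 + \sum_j nrm (col j M)).
  by rewrite ltr_pwDl // sumr_ge0 // => j _; exact: nrm_ge0.
move=> x; have -> : M *m x = \sum_j x j 0 *: col j M.
  apply/colP => i; rewrite !mxE summxE; apply: eq_bigr => j _.
  by rewrite !mxE mulrC.
rewrite (le_trans (ler_nrm_sum _ _ _ _)) // mulrDl mul1r mulr_suml.
rewrite (@le_trans _ _ (\sum_j nrm (col j M) * `|x|)) ?lerDr ?normr_ge0 //.
apply: ler_sum => j _; rewrite nrmZ mulrC ler_wpM2l ?nrm_ge0 //.
exact: ler_entry_norm.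
Qed.

Lemma nrm_ub : exists2 C, 0 < C & forall x, nrm x <= C * `|x|.
Proof.
have [C C0 h] := nrm_mulmx_ub 1%:M; exists C => // x.
by have := h x; rewrite mul1mx.
Qed.

Lemma cvg_nrm {T : Type} {F : set_system T} {FF : Filter F} (u : T -> 'cV[R]_n)
    (l : 'cV[R]_n) :
  u x @[x --> F] --> l -> nrm (u x) @[x --> F] --> nrm l.
Proof.
have [C C0 hC] := nrm_ub.
move=> /cvgrPdist_le ul; apply/cvgrPdist_le => e e0.
have := ul _ (divr_gt0 e0 C0); apply: filterS => x.
rewrite ler_pdivlMr // mulrC => /(le_trans (hC _)); apply: le_trans.
rewrite ler_norml; apply/andP; split.
  by rewrite lerBrDr addrC lerBlDl nrm_distC -{1}(subrK l (u x)) ler_nrmD.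
by rewrite lerBlDr -{1}(subrK (u x) l) ler_nrmD.
Qed.

(** The continuous function [nrm] attains a positive minimum on the compact unit sphere of the sup
    norm, and [c] is the inverse of that minimum. The sphere consists of row vectors so that
    [bounded_closed_compact] applies; hence the transpositions. *)
Lemma nrm_lb : exists2 c, 0 < c & forall x, `|x| <= c * nrm x.
Proof.
pose S := [set v : 'rV[R]_n | `|v| = 1].
(* The sphere is empty in dimension 0; every vector is then zero. *)
have [S0|/set0P[v0 Sv0]] := eqVneq S set0.
  exists 1 => // x; have [->|x0] := eqVneq x 0; first by rewrite normr0 mul1r nrm_ge0.
  have : S (`|x^T|^-1 *: x^T).
    rewrite /S /= normrZ normfV normr_id mulVf // normr_eq0.
    by apply: contra_neq x0 => /(congr1 trmx); rewrite trmxK trmx0.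
  by rewrite S0.
have cS : compact S.
  apply: bounded_closed_compact.
    by exists 1; split => // M M1 v /= ->; exact: ltW.
  rewrite (_ : S = (fun v : 'rV[R]_n => `|v|) @^-1` [set 1]) //.
  apply: preimage_closed => [v _|]; first exact: norm_continuous.
  exact: closed_eq.
have cn : {within S, continuous (fun v : 'rV[R]_n => nrm v^T)}.
  apply: continuous_subspaceT => v.
  suff tv : w^T @[w --> v] --> v^T by exact: (cvg_nrm _ _ tv).
  apply/(@cvg_mxP _ _ _ (nbhs_filter v)) => i j; rewrite mxE.
  by apply: cvg_congr (@coord_continuous R 1 n j i v); apply: nearW => w; rewrite mxE.
have [c Sc hc] := compact_EVT_min (ex_intro _ v0 Sv0) cS cn.
have nc : 0 < nrm c^T.
  rewrite lt_def nrm_ge0 andbT; apply/eqP => /nrm_eq0 c0.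
  by have := set_mem Sc; rewrite /S /= -normr_trmx c0 normr0 => /eqP; rewrite eq_sym oner_eq0.
exists (nrm c^T)^-1; first by rewrite invr_gt0.
move=> x; have [->|x0] := eqVneq x 0; first by rewrite normr0 mulr_ge0 ?nrm_ge0 // invr_ge0 ltW.
have nx : 0 < `|x| by rewrite normr_gt0.
have : `|x|^-1 *: x^T \in S.
  by apply/mem_set; rewrite /S /= normrZ normfV normr_id normr_trmx mulVf // gt_eqF.
move/hc; rewrite linearZ /= trmxK nrmZ normfV normr_id.
by rewrite mulrC ler_pdivlMr // => h; rewrite mulrC ler_pdivlMr // mulrC.
Qed.

(** The supremum defining [opnorm] is an upper bound only once its set is known to be bounded;
    [C * c], from the two norm comparisons, bounds it. *)
Lemma opnorm_ub (M : 'M[R]_n) x : nrm (M *m x) <= opnorm nrm M * nrm x.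
Proof.
have [C C0 hC] := nrm_mulmx_ub M; have [c c0 hc] := nrm_lb.
have [->|x0] := eqVneq x 0; first by rewrite mulmx0 nrm0 mulr0.
have nx : 0 < nrm x.
  by rewrite lt_def nrm_ge0 andbT; apply: contra_neq x0; exact: nrm_eq0.
rewrite -ler_pdivrMr // mulrC; apply: ub_le_sup.
  exists (C * c) => _ [v /= v1 <-]; rewrite (le_trans (hC _)) // ler_pM2l //.
  by rewrite (le_trans (hc _)) // ger_pMr.
exists ((nrm x)^-1 *: x) => /=.
  by rewrite nrmZ ger0_norm ?invr_ge0 ?nrm_ge0 // mulVf // gt_eqF.
by rewrite -scalemxAr nrmZ ger0_norm // invr_ge0 nrm_ge0.
Qed.

End Norm.

(** * The mean value inequality *)

Section MeanValue.
Context {R : realType}.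

Lemma is_derive_cvg (w : R -> R) t l : is_derive t (1 : R) w l ->
  (s - t)^-1 * (w s - w t) @[s --> t^'] --> l.
Proof.
move=> wl; have dw : derivable w t 1 by exact: ex_derive.
have := derive_val (df := l); rewrite /derive => <-.
move: dw => /cvgrPdist_lt dw.
apply/cvgrPdist_lt => e e0; move: (dw _ e0).
rewrite !near_withinE => /nbhs_ballP[d d0 hd]; apply/nbhs_ballP; exists d => // s.
rewrite /ball /= => ts st; have := hd (s - t).
rewrite /ball /= sub0r opprB subr_eq0 => /(_ ts st).
by rewrite [_%:A]mulr1 subrK.
Qed.

(** Continuous induction: let [S] be the set of points related to [a]. The local hypothesis at
    [sup S] relates [a] to [sup S] through a nearby point of [S], and would then reach beyond it if
    [sup S < b]. *)
Lemma segment_chain (K : R -> R -> Prop) (a b : R) : a <= b ->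
  (forall x y z, K x y -> K y z -> K x z) ->
  (forall t, a <= t <= b -> \forall s \near t, a <= s <= b ->
     (s <= t -> K s t) /\ (t <= s -> K t s)) ->
  K a b.
Proof.
move=> ab Ktr Kloc.
pose S := [set t | a <= t <= b /\ K a t].
have Sa : S a.
  have aab : a <= a <= b by rewrite lexx.
  by split=> //; have /nbhs_singleton/(_ aab)[+ _] := Kloc _ aab; apply.
have Sb : has_sup S by split; [exists a|exists b => t [/andP[]]].
have ac : a <= sup S by apply: ub_le_sup => //; case: Sb.
have cb : sup S <= b by apply: ge_sup => [|t [/andP[]]//]; exists a.
have /nbhs_ballP[d /= d0 hd] := Kloc (sup S) (introT andP (conj ac cb)).
have [t [/andP[atl tb] Kat] ct] := sup_adherent d0 Sb.
have tc : t <= sup S by apply: ub_le_sup; [case: Sb|split=> //; apply/andP].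
have Kac : K a (sup S).
  apply: (Ktr _ t) => //; apply: (hd t _ _).1 => //; last exact/andP.
  by rewrite /ball /= ger0_norm ?subr_ge0 // ltrBlDl -ltrBlDr.
have [bc|{}cb] := leP b (sup S).
  by have -> : b = sup S by apply/eqP; rewrite eq_le bc cb.
pose s := Num.min (sup S + d / 2) b.
have cs : sup S < s by rewrite lt_min cb ltrDl divr_gt0.
have sb : s <= b by rewrite ge_min lexx orbT.
have asb : a <= s <= b by rewrite sb andbT (le_trans ac) // ltW.
have : S s.
  split=> //; apply: Ktr Kac _; apply: (hd s _ _).2 => //; last exact: ltW.
  rewrite /ball /= distrC gtr0_norm ?subr_gt0 // ltrBlDl gt_min ltrD2l.
  by rewrite ltr_pdivrMr // ltr_pMr // ltr1n.
by move=> /(ub_le_sup (proj2 Sb)); rewrite leNgt cs.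
Qed.

(** This stands in for bounding the norm of an integral by the integral of the norm; it integrates
    nothing and asks no continuity of [dv]. *)
Lemma ler_nrm_increment {n : nat} (nrm : 'cV[R]_n -> R) (tau : \bar R)
    (v dv : R -> 'cV[R]_n) (w dw : R -> R) (a b : R) :
  is_norm nrm -> deriv_on tau v dv -> 0 <= a -> a <= b -> Iv tau b ->
  (forall t, a <= t <= b -> is_derive t (1 : R) w (dw t)) ->
  (forall t, a <= t <= b -> nrm (dv t) <= dw t) ->
  nrm (v b - v a) <= w b - w a.
Proof.
move=> nP vd a0 ab Ib wd dvw.
suff H e : 0 < e -> nrm (v b - v a) <= w b - w a + e * (b - a).
  apply/ler_addgt0Pr => e e0.
  (* The added 1 allows the division when [a = b]. *)
  have c0 : 0 < b - a + 1 by rewrite ltr_wpDl // subr_ge0.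
  rewrite (le_trans (H _ (divr_gt0 e0 c0))) // lerD2l -mulrA ger_pMr //.
  by rewrite mulrC ler_pdivrMr // mul1r lerDl.
move=> e0.
(* The slack [e] makes [K] hold locally; being transitive, it then holds on [a, b]. *)
pose K x y := nrm (v y - v x) <= w y - w x + e * (y - x).
apply: (segment_chain K a b ab) => [x y z Kxy Kyz|t atb].
  rewrite /K (le_trans (ler_nrm_dist nP _ (v y) _)) //.
  rewrite (le_trans (lerD Kyz Kxy)) // addrACA -mulrDr.
  by rewrite [X in X + _]addrA subrK [X in _ * X]addrA subrK.
have It : Iv tau t by case/andP: atb => at0 tb; apply: Iv_le Ib => //; exact: le_trans at0.
have e2 : 0 < e / 2 by rewrite divr_gt0.
pose proof (cvg_nrm nP _ _ (vd _ It)) as h1.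
(* Near [t] the quotient of [v] has norm at most [dw t + e / 2], and that of [w] is at least
   [dw t - e / 2]: the slack is split in two. *)
have h2 : \forall s \near within [set s | Iv tau s /\ s != t] (nbhs t),
    nrm ((s - t)^-1 *: (v s - v t)) <= dw t + e / 2.
  apply: (cvgr_le _ h1 (dw t + e / 2)); rewrite (le_lt_trans (dvw _ atb)) // ltrDl //.
have h3 : \forall s \near t^', dw t - e / 2 <= (s - t)^-1 * (w s - w t).
  by apply: (cvgr_ge _ (is_derive_cvg _ _ _ (wd _ atb)) (dw t - e / 2)); rewrite ltrBlDr ltrDl.
move: h2 h3; rewrite !near_withinE; apply: filterS2 => s h2 h3 /andP[as_ sb].
have [->|st] := eqVneq s t; first by rewrite /K !subrr (nrm0 nP) mulr0 addr0.
have Is : Iv tau s by apply: Iv_le Ib => //; exact: le_trans as_.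
have {}h2 := h2 (conj Is st); have {}h3 := h3 st.
have : nrm ((s - t)^-1 *: (v s - v t)) <= (s - t)^-1 * (w s - w t) + e.
  by move: h2 h3; lra.
rewrite (nrmZ nP) normfV; move=> h; split=> st'.
  have d0 : 0 < t - s by rewrite subr_gt0 lt_neqAle st.
  move: h; rewrite -(opprB t s) normrN gtr0_norm // invrN mulNr -mulrN opprB.
  rewrite ler_pdivrMl // mulrDr mulrA divff ?gt_eqF // mul1r.
  by rewrite /K (nrm_distC nP) [_ * e]mulrC.
have d0 : 0 < s - t by rewrite subr_gt0 lt_neqAle eq_sym st.
move: h; rewrite gtr0_norm // ler_pdivrMl // mulrDr.
by rewrite mulrA divff ?gt_eqF // mul1r /K [_ * e]mulrC.
Qed.

End MeanValue.

(** * Antiderivatives of continuous functions on the interval *)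

Section Antiderivative.
Context {R : realType}.

(** Precomposing with [Num.max 0] turns continuity within the interval into two-sided continuity,
    also at 0. *)
Lemma cvg_max0 (tau : \bar R) (t : R) : (0 < tau)%E -> (t%:E < tau)%E ->
  Num.max 0 s @[s --> t] --> within (Iv tau) (nbhs (Num.max 0 t)).
Proof.
move=> tau0 tt P hP.
have mx : Num.max 0 s @[s --> t] --> Num.max 0 t.
  apply: (@continuous_max R R (cst 0) id t); [exact: cvg_cst|exact: cvg_id].
have Pm := mx _ hP.
have st : \forall s \near t, (s%:E < tau)%E.
  move: tt {Pm mx hP}; case: tau tau0 => [r| |] // _.
    rewrite lte_fin => tr; near=> s; rewrite lte_fin; near: s.
    exact: lt_nbhsl.
  by move=> _; near=> s; rewrite ltry.
change (\forall s \near t, P (Num.max 0 s)); apply: filterS2 st Pm => s ss; apply.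
by split; rewrite ?le_max ?lexx //; case: (leP 0 s).
Unshelve. all: by end_near.
Qed.

(* [u] is extended to negative times by [u 0], so that [0] is interior to the domain
   of integration. *)
Lemma antiderivative_real (tau : \bar R) (u : R -> R) : (0 < tau)%E ->
  {within Iv tau, continuous u} -> exists U : R -> R, forall t, Iv tau t ->
    (s - t)^-1 * (U s - U t) @[s --> within [set s | Iv tau s /\ s != t] (nbhs t)]
      --> u t.
Proof.
move=> tau0 /subspace_continuousP cu.
pose u' s := u (Num.max 0 s).
have cu' s : (s%:E < tau)%E -> {for s, continuous u'}.
  move=> stau; have Im : Iv tau (Num.max 0 s).
    by split; rewrite ?le_max ?lexx //; case: (leP 0 s).
  exact: cvg_comp (cvg_max0 tau s tau0 stau) (cu _ Im).
pose U x := (\int[lebesgue_measure]_(s in [set` `[-1, x]]) u' s)%R.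
(* The fundamental theorem of calculus is applied on [[-1, b]], where [b] is chosen so that [t] is
   an interior point. *)
exists U => t It; have [b tb Ib] := Iv_gt _ _ It.
have t0 := Iv_ge0 _ _ It.
have iu : lebesgue_measure.-integrable `[-1, b] (EFin \o u').
  apply: continuous_compact_integrable; first exact: segment_compact.
  apply: continuous_in_subspaceT => s; rewrite inE /= in_itv /= => /andP[_ sb].
  by apply: cu'; case: Ib => _; apply: le_lt_trans; rewrite lee_fin.
have t1 : -1 < t by rewrite (lt_le_trans _ t0) // ltrN10.
have [dU dUt] := continuous_FTC1_closed tb iu t1 (cu' t (proj2 It)).
have : is_derive t (1 : R) U (u t).
  apply: DeriveDef => //; rewrite -derive1E dUt /u'.
  by rewrite max_r.
move=> /is_derive_cvg; apply: cvg_trans; apply: cvg_app.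
by apply: within_subset => s [].
Qed.

Lemma antiderivative {n : nat} (tau : \bar R) (u : R -> 'cV[R]_n) : (0 < tau)%E ->
  {within Iv tau, continuous u} -> exists U, deriv_on tau U u.
Proof.
move=> tau0 /subspace_continuousP cu.
have /choice[U hU] : forall i : 'I_n, exists V : R -> R, forall t, Iv tau t ->
    (s - t)^-1 * (V s - V t) @[s --> within [set s | Iv tau s /\ s != t] (nbhs t)]
      --> u t i 0.
  move=> i; apply: antiderivative_real => //; apply/subspace_continuousP => t It.
  by have /cvg_mxP := cu _ It; apply.
exists (fun s => \col_i U i s) => t It; apply/cvg_mxP => i j; rewrite ord1.
by apply: cvg_congr (hU i t It); apply: nearW => s; rewrite !mxE.
Qed.

End Antiderivative.

(** * Convergence in the given norm and a fixed point theorem *)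

Section NormConvergence.
Context {R : realType} {n : nat} {nrm : 'cV[R]_n -> R} (nrmP : is_norm nrm).

Lemma cvg_nrmP {T : Type} {F : set_system T} {FF : Filter F} (u : T -> 'cV[R]_n)
    (l : 'cV[R]_n) :
  u x @[x --> F] --> l <-> forall e, 0 < e -> \forall x \near F, nrm (l - u x) < e.
Proof.
split=> [ul e e0|ul].
  have [C C0 hC] := nrm_ub nrmP.
  move/cvgrPdist_lt : ul => /(_ _ (divr_gt0 e0 C0)); apply: filterS => x.
  by rewrite ltr_pdivlMr // mulrC; exact: le_lt_trans.
have [c c0 hc] := nrm_lb nrmP.
apply/cvgrPdist_lt => e e0; have := ul _ (divr_gt0 e0 c0); apply: filterS => x.
by rewrite ltr_pdivlMr // mulrC; exact: le_lt_trans.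
Qed.

Lemma cvg_seq_nrm (u : nat -> 'cV[R]_n) (E : nat -> R) :
  (E k @[k --> \oo] --> 0) -> (forall k m, (k <= m)%N -> nrm (u m - u k) <= E k) ->
  cvgn u.
Proof.
move=> E0 uE; have [c c0 hc] := nrm_lb nrmP.
apply/cauchy_cvgP; apply/cauchy_exP => e e0.
move/cvgrPdist_lt : E0 => /(_ _ (divr_gt0 e0 c0)) [K _ hK].
exists (u K); exists K => // m /= Km; rewrite -ball_normE /= distrC.
rewrite (le_lt_trans (hc _)) // mulrC -ltr_pdivlMr // (le_lt_trans (uE _ _ Km)) //.
by have := hK K (leqnn _); rewrite /= sub0r normrN; exact/le_lt_trans/ler_norm.
Qed.

Lemma cvg_nrm_le {T : Type} {F : set_system T} {FF : ProperFilter F}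
    (u : T -> 'cV[R]_n) (l a : 'cV[R]_n) (c : R) :
  u x @[x --> F] --> l -> (\forall x \near F, nrm (u x - a) <= c) -> nrm (l - a) <= c.
Proof.
move=> ul; apply: cvgr_to_le; apply: (cvg_nrm nrmP).
exact: (cvgB ul (cvg_cst a)).
Qed.

(** Picard iteration from 0 with pointwise limits on [I]. Functions are total and unconstrained off
    [I], so sup-distances are replaced by explicit bounds [M] valid on [I]. *)
Lemma contraction_fixpoint_within (I : set R) (F : (R -> 'cV[R]_n) -> R -> 'cV[R]_n)
    (rho q : R) :
  let Z z := {within I, continuous z} /\ forall t, I t -> nrm (z t) <= rho in
  0 <= rho -> 0 <= q -> q < 1 ->
  (forall z, Z z -> Z (F z)) ->
  (forall z1 z2 M, Z z1 -> Z z2 -> (forall t, I t -> nrm (z1 t - z2 t) <= M) ->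
     forall t, I t -> nrm (F z1 t - F z2 t) <= q * M) ->
  exists2 z, Z z & forall t, I t -> F z t = z t.
Proof.
move=> Z rho0 q0 q1 FZ Fq.
pose z k := iter k F (fun=> 0).
have Zz k : Z (z k).
  elim: k => [|k ih]; last exact: FZ.
  by split=> [|t _]; [exact: cst_continuous|rewrite nrm0].
(* Comparing [z (j + k)] with [z k] starts from the crude bound [2 rho] at [k = 0], which
   avoids summing a geometric series. *)
pose E k := q ^+ k * (rho + rho).
have zE j k t : I t -> nrm (z (j + k)%N t - z k t) <= E k.
  elim: k t => [|k ih] t It.
    rewrite /E expr0 mul1r (le_trans (ler_nrmD nrmP _ _)) // nrmN // lerD //.
      by apply: (Zz _).2.
    by apply: (Zz _).2.
  rewrite addnS /= /E exprS -mulrA; exact: Fq.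
have E0 : E k @[k --> \oo] --> 0.
  rewrite -(mul0r (rho + rho)); apply: cvgMr_tmp; apply: cvg_expr.
  by rewrite ger0_norm.
pose w t := limn (fun k => z k t).
have zw t : I t -> z k t @[k --> \oo] --> w t.
  move=> It; apply: (cvg_seq_nrm _ E E0) => k m km.
  by rewrite -(subnK km); exact: zE.
have wE k t : I t -> nrm (w t - z k t) <= E k.
  move=> It; apply: (cvg_nrm_le _ _ _ _ (zw t It)).
  by exists k => // m /= km; rewrite -(subnK km); exact: zE.
have Zw : Z w.
  split=> [|t It]; last first.
    rewrite -[w t]subr0; apply: (cvg_nrm_le _ _ _ _ (zw t It)).
    by apply: nearW => k; rewrite subr0; apply: (Zz k).2.
  (* A uniform limit of continuous functions is continuous, by three errors of size [e / 3]. *)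
  apply/subspace_continuousP => t It; apply/cvg_nrmP => e e0.
  have e3 : 0 < e / 3 by rewrite divr_gt0.
  have [k Ek] : exists k, E k < e / 3.
    move/cvgrPdist_lt : E0 => /(_ _ e3) [K _ hK]; exists K.
    by have := hK K (leqnn _); rewrite /= sub0r normrN; exact/le_lt_trans/ler_norm.
  have /subspace_continuousP/(_ t It)/cvg_nrmP/(_ _ e3) := (Zz k).1.
  rewrite !near_withinE; apply: filterS => s h Is; have {}h := h Is.
  have h1 := wE k t It; have := wE k s Is; rewrite nrm_distC // => h2.
  have h3 := ler_nrm_dist nrmP (w t) (z k t) (w s).
  have h4 := ler_nrm_dist nrmP (z k t) (z k s) (w s).
  by move: h h1 h2 h3 h4 Ek; lra.
exists w => // t It; apply/eqP; rewrite -subr_eq0; apply/eqP/(nrm_eq0 nrmP).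
apply/eqP; rewrite eq_le nrm_ge0 // andbT.
(* Both [F w] and [w] lie within [E k] of [z k.+1 = F (z k)], so they differ by at most [E k + E k]
   for every [k]. *)
have EE0 : E k + E k @[k --> \oo] --> 0.
  rewrite -[X in _ --> X](addr0 0); exact: (cvgD E0 E0).
apply: (cvgr_to_ge EE0); apply: nearW => k.
have h1 := Fq _ _ _ Zw (Zz k) (wE k) t It; have := wE k.+1 t It.
rewrite nrm_distC // => h2; have h3 := ler_nrm_dist nrmP (F w t) (z k.+1 t) (w t).
have : q * E k <= E k.
  by rewrite ler_piMl ?(ltW q1) // /E mulr_ge0 ?exprn_ge0 // addr_ge0.
have : E k.+1 <= E k.
  by rewrite /E exprS -mulrA ler_piMl ?(ltW q1) // mulr_ge0 ?exprn_ge0 // addr_ge0.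
by move: h1 h2 h3; rewrite /z /= -/(z k); lra.
Qed.

End NormConvergence.

(** * Estimates from the exponential dichotomy *)

Section Green.
Context {R : realType} {n : nat} {nrm : 'cV[R]_n -> R} (nrmP : is_norm nrm).

Lemma is_derive_expR_affine (c k t0 s : R) :
  is_derive s (1 : R) (fun s => c * expR (k * (s - t0))) (c * (k * expR (k * (s - t0)))).
Proof.
have h1 : is_derive s (1 : R) (fun s : R => k * (s - t0)) (k * 1).
  apply: is_deriveZ; rewrite -[X in is_derive _ _ _ X]subr0.
  exact: is_deriveB.
have h2 := @is_derive1_comp R expR (fun s : R => k * (s - t0)) s _ _
  (is_derive_expR (k * (s - t0))) h1.
have := is_deriveZ c h2; rewrite mulr1 [_ * k]mulrC; exact.
Qed.

(** Invariance of [P] between times 0 and [s] reads [P s *m Phi s = Phi s *m Q], so the operator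
    [transition Phi t s *m P s] factors as [Phi t *m Q *m invmx (Phi s)]. The variable [s] is
    thereby separated from [t], and antiderivatives in [s] serve all [t] at once. *)
Lemma dichotomy_projection (A : R -> 'M[R]_n) (N lam : R) :
  exp_dichotomy nrm A N lam -> exists Phi Q, [/\ fundamental A Phi,
    forall s t x, 0 <= s -> s <= t ->
      nrm (Phi t *m (Q *m (invmx (Phi s) *m x))) <= N * expR (- lam * (t - s)) * nrm x &
    forall s t x, 0 <= t -> t <= s ->
      nrm (Phi t *m ((1%:M - Q) *m (invmx (Phi s) *m x)))
        <= N * expR (- lam * (s - t)) * nrm x].
Proof.
move=> [N0 [lam0 [Phi [FPhi [P [_ [PT [dich1 dich2]]]]]]]].
have uPhi := FPhi.1.
pose Q := invmx (Phi 0) *m P 0 *m Phi 0.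
have PPhi s : 0 <= s -> P s *m Phi s = Phi s *m Q.
  move=> s0; have := PT s 0 s0 (lexx 0); rewrite /transition mulmxA.
  move=> /(congr1 (mulmx^~ (Phi 0))); rewrite mulmxKV ?uPhi // => ->.
  by rewrite /Q !mulmxA.
have QPhi s : 0 <= s -> invmx (Phi s) *m P s = Q *m invmx (Phi s).
  move=> s0; rewrite -[RHS](mulKmx (uPhi s s0)) [Phi s *m (_ *m _)]mulmxA -PPhi //.
  by rewrite -[P s *m _ *m _]mulmxA mulmxV ?uPhi // mulmx1.
exists Phi, Q; split => // s t x.
- move=> s0 st; have t0 := le_trans s0 st.
  rewrite (_ : _ *m _ = (transition Phi t s *m P s) *m x).
    by rewrite (le_trans (opnorm_ub nrmP _ _)) // ler_wpM2r ?nrm_ge0 ?dich1.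
  by rewrite /transition -[Phi t *m _ *m _]mulmxA QPhi // !mulmxA.
- move=> t0 ts; have s0 := le_trans t0 ts.
  rewrite (_ : _ *m _ = (transition Phi t s *m (1%:M - P s)) *m x).
    by rewrite (le_trans (opnorm_ub nrmP _ _)) // ler_wpM2r ?nrm_ge0 ?dich2.
  rewrite /transition mulmxBr mulmx1 -[Phi t *m _ *m P s]mulmxA QPhi //.
  by rewrite !mulmxBl mul1mx mulmxBr !mulmxA.
Qed.

(** Mean value inequality on [[0, t]] against [N / lam * M * expR (lam * (s - t))], whose derivative
    is the dichotomy bound. Its value at [t] is [N / lam * M], and its value at 0 is nonnegative and
    dropped. *)
Lemma stable_bound (Phi : R -> 'M[R]_n) (Q : 'M[R]_n) (N lam M : R) (tau : \bar R)
    (r U : R -> 'cV[R]_n) (t : R) : 0 < N -> 0 < lam ->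
  (forall s t x, 0 <= s -> s <= t ->
    nrm (Phi t *m (Q *m (invmx (Phi s) *m x))) <= N * expR (- lam * (t - s)) * nrm x) ->
  deriv_on tau U (fun s => Q *m (invmx (Phi s) *m r s)) ->
  (forall s, Iv tau s -> nrm (r s) <= M) -> Iv tau t ->
  nrm (Phi t *m (U t - U 0)) <= N / lam * M.
Proof.
move=> N0 lam0 dich dU rM It; have t0 := Iv_ge0 _ _ It.
have M0 : 0 <= M by rewrite (le_trans _ (rM _ It)) // nrm_ge0.
have dv := deriv_on_mulmx _ _ _ _ _ (deriv_on_cst tau (Phi t)) dU.
rewrite mulmxBr.
apply: (@le_trans _ _ (N / lam * M * expR (lam * (t - t)) -
    N / lam * M * expR (lam * (0 - t)))); last first.
  rewrite subrr mulr0 expR0 mulr1 gerBl mulr_ge0 ?expR_ge0 //.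
  by rewrite mulr_ge0 // divr_ge0 // ltW.
apply: (ler_nrm_increment nrm tau _ _ (fun s => N / lam * M * expR (lam * (s - t)))
    (fun s => N / lam * M * (lam * expR (lam * (s - t)))) 0 t nrmP dv) => //.
  by move=> s _; exact: is_derive_expR_affine.
move=> s /andP[s0 st]; rewrite mul0mx add0r (le_trans (dich _ _ _ s0 st)) //.
rewrite mulNr -mulrN opprB.
rewrite (_ : N / lam * M * _ = N * expR (lam * (s - t)) * M); last first.
  by field; rewrite gt_eqF.
rewrite ler_wpM2l ?mulr_ge0 ?expR_ge0 ?(ltW N0) //; apply: rM.
exact: Iv_le It.
Qed.

(** Here [Q] stands for the complementary projection. Both endpoint terms are kept: [a = t] gives
    the size of the unstable part, and [t = 0] gives a Cauchy estimate as [a] and [b] approach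
    [tau]. *)
Lemma unstable_bound (Phi : R -> 'M[R]_n) (Q : 'M[R]_n) (N lam M : R) (tau : \bar R)
    (r V : R -> 'cV[R]_n) (t a b : R) : 0 < N -> 0 < lam ->
  (forall s t x, 0 <= t -> t <= s ->
    nrm (Phi t *m (Q *m (invmx (Phi s) *m x))) <= N * expR (- lam * (s - t)) * nrm x) ->
  deriv_on tau V (fun s => Q *m (invmx (Phi s) *m r s)) ->
  (forall s, Iv tau s -> nrm (r s) <= M) -> 0 <= t -> t <= a -> a <= b -> Iv tau b ->
  nrm (Phi t *m (V b - V a)) <=
    N / lam * M * expR (- lam * (a - t)) - N / lam * M * expR (- lam * (b - t)).
Proof.
move=> N0 lam0 dich dV rM t0 ta ab Ib.
have dv := deriv_on_mulmx _ _ _ _ _ (deriv_on_cst tau (Phi t)) dV.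
rewrite mulmxBr; set c := N / lam * M.
rewrite [leRHS](_ : _ = - c * expR (- lam * (b - t)) - - c * expR (- lam * (a - t))).
  apply: (ler_nrm_increment nrm tau _ _ (fun s => - c * expR (- lam * (s - t)))
    (fun s => - c * (- lam * expR (- lam * (s - t)))) a b nrmP dv) => //.
  exact: le_trans ta.
  by move=> s _; exact: is_derive_expR_affine.
  move=> s /andP[as_ sb]; have ts := le_trans ta as_.
  rewrite mul0mx add0r (le_trans (dich _ _ _ t0 ts)) //.
  rewrite (_ : - c * _ = N * expR (- lam * (s - t)) * M); last first.
    by rewrite /c; field; rewrite gt_eqF.
  rewrite ler_wpM2l ?mulr_ge0 ?expR_ge0 ?(ltW N0) //; apply: rM.
  exact: Iv_le (le_trans t0 ts) sb Ib.
by rewrite !(mulNr c) opprK addrC.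
Qed.

End Green.

(** * The Green operator of the linear equation *)

Section GreenOperator.
Context {R : realType} {n : nat} {nrm : 'cV[R]_n -> R} (nrmP : is_norm nrm).

(** At [t = 0], [unstable_bound] controls increments of [V] along [u] by [E k - E m], up to the
    factor [D] that undoes [Phi 0]. As [E] is nonincreasing and bounded below, this is at most
    [E k - limn E], which tends to 0 whether [tau] is finite or not. *)
Lemma unstable_cvg (Phi : R -> 'M[R]_n) (Q : 'M[R]_n) (N lam M : R) (tau : \bar R)
    (r V : R -> 'cV[R]_n) (u : nat -> R) : 0 < N -> 0 < lam ->
  (forall s t x, 0 <= t -> t <= s ->
    nrm (Phi t *m (Q *m (invmx (Phi s) *m x))) <= N * expR (- lam * (s - t)) * nrm x) ->
  Phi 0 \in unitmx ->
  deriv_on tau V (fun s => Q *m (invmx (Phi s) *m r s)) ->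
  (forall s, Iv tau s -> nrm (r s) <= M) ->
  nondecreasing_seq u -> (forall k, Iv tau (u k)) ->
  cvgn (fun k => V (u k)).
Proof.
move=> N0 lam0 dich uPhi dV rM und Iu.
have M0 : 0 <= M by rewrite (le_trans _ (rM _ (Iu 0%N))) // nrm_ge0.
pose E k := N / lam * M * expR (- lam * (u k - 0)).
have cE0 : 0 <= N / lam * M by rewrite mulr_ge0 // divr_ge0 // ltW.
have Endec : nonincreasing_seq E.
  move=> k l kl; rewrite /E ler_wpM2l // ler_expR !mulNr lerN2 ler_pM2l //.
  by rewrite lerD2r; exact: und.
have Ecvg : cvgn E.
  apply: nonincreasing_is_cvgn => //; exists 0 => _ [k _ <-].
  by rewrite /E mulr_ge0 // expR_ge0.
have [c c0 hc] := nrm_lb nrmP; have [C C0 hC] := nrm_mulmx_ub nrmP (invmx (Phi 0)).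
pose D := C * c.
have D0 : 0 < D by rewrite mulr_gt0.
apply: (cvg_seq_nrm nrmP _ (fun k => D * (E k - limn E))).
  rewrite -(mulr0 D) -(subrr (limn E)); apply: cvgMl_tmp.
  exact: (cvgB Ecvg (cvg_cst _)).
move=> k m km; rewrite -[V (u m) - _](mulKmx uPhi) (le_trans (hC _)) //.
rewrite -mulrA ler_pM2l // (le_trans (hc _)) // ler_pM2l //.
apply: (le_trans (unstable_bound nrmP _ _ _ _ _ _ _ _ 0 (u k) (u m)
  N0 lam0 dich dV rM _ _ _ _)) => //.
- exact: Iv_ge0 (Iu k).
- exact: und.
- by rewrite lerD2l lerN2; exact: nonincreasing_cvgn_ge.
Qed.

(** Stable and unstable parts contribute [N / lam * M] each, the latter by passing to the limit
    along [u]. Arbitrary antiderivatives [U] and [V] are allowed so that differences of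
    antiderivatives are covered too. *)
Lemma dichotomy_bound (Phi : R -> 'M[R]_n) (Q : 'M[R]_n) (N lam M : R) (tau : \bar R)
    (r U V : R -> 'cV[R]_n) (u : nat -> R) (l : 'cV[R]_n) (t : R) : 0 < N -> 0 < lam ->
  (forall s t x, 0 <= s -> s <= t ->
    nrm (Phi t *m (Q *m (invmx (Phi s) *m x))) <= N * expR (- lam * (t - s)) * nrm x) ->
  (forall s t x, 0 <= t -> t <= s ->
    nrm (Phi t *m ((1%:M - Q) *m (invmx (Phi s) *m x)))
      <= N * expR (- lam * (s - t)) * nrm x) ->
  deriv_on tau U (fun s => Q *m (invmx (Phi s) *m r s)) ->
  deriv_on tau V (fun s => (1%:M - Q) *m (invmx (Phi s) *m r s)) ->
  (forall s, Iv tau s -> nrm (r s) <= M) ->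
  (forall k, Iv tau (u k)) -> (forall t, Iv tau t -> \forall k \near \oo, t <= u k) ->
  V (u k) @[k --> \oo] --> l -> Iv tau t ->
  nrm (Phi t *m ((U t - U 0) + (V t - l))) <= 2 * N / lam * M.
Proof.
move=> N0 lam0 dich1 dich2 dU dV rM Iu ucof Vl It.
have M0 : 0 <= M by rewrite (le_trans _ (rM _ It)) // nrm_ge0.
have t0 := Iv_ge0 _ _ It.
have -> : 2 * N / lam * M = N / lam * M + N / lam * M by field; rewrite gt_eqF.
rewrite mulmxDr (le_trans (ler_nrmD nrmP _ _)) // lerD //.
  exact: (stable_bound nrmP _ _ _ _ _ _ _ _ _ N0 lam0 dich1 dU rM It).
rewrite mulmxBr (nrm_distC nrmP).
have Pl : Phi t *m V (u k) @[k --> \oo] --> Phi t *m l.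
  exact: (cvg_mulmx (fun=> Phi t) _ _ _ (cvg_cst (Phi t)) Vl).
apply: (cvg_nrm_le nrmP _ _ _ _ Pl).
have := ucof _ It; apply: filterS => k tk; rewrite -mulmxBr.
apply: (le_trans (unstable_bound nrmP _ _ _ _ _ _ _ _ t t (u k) N0 lam0 dich2 dV rM _ _ _ _)) => //.
rewrite subrr mulr0 expR0 mulr1 gerBl mulr_ge0 ?expR_ge0 //.
by rewrite mulr_ge0 // divr_ge0 // ltW.
Qed.

Lemma dichotomy_operator (A : R -> 'M[R]_n) (N lam : R) (tau : \bar R) :
  exp_dichotomy nrm A N lam -> (0 < tau)%E ->
  exists G : (R -> 'cV[R]_n) -> R -> 'cV[R]_n,
  let B r := {within Iv tau, continuous r} /\
    exists M, forall t, Iv tau t -> nrm (r t) <= M in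
  [/\ forall r, B r -> deriv_on tau (G r) (fun t => A t *m G r t + r t),
    forall r M, B r -> (forall t, Iv tau t -> nrm (r t) <= M) ->
      forall t, Iv tau t -> nrm (G r t) <= 2 * N / lam * M &
    forall r1 r2 M, B r1 -> B r2 ->
      (forall t, Iv tau t -> nrm (r1 t - r2 t) <= M) ->
      forall t, Iv tau t -> nrm (G r1 t - G r2 t) <= 2 * N / lam * M].
Proof.
move=> dich tau0; have [N0 [lam0 _]] := dich.
have [Phi [Q [[uPhi [dPhi [dPhiP dPhiE]]] dich1 dich2]]] := dichotomy_projection nrmP _ _ _ dich.
have [u [und Iu ucof]] := Iv_cofinal _ tau0.
(* [J] picks one antiderivative of each continuous [v]; on other functions it has a dummy value. *)
have /choice[J hJ] : forall v : R -> 'cV[R]_n, exists U,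
    {within Iv tau, continuous v} -> deriv_on tau U v.
  move=> v; have [cv|ncv] := pselect {within Iv tau, continuous v}; last by exists v.
  by have [U hU] := antiderivative _ _ tau0 cv; exists U.
pose pull (S : 'M[R]_n) (r : R -> 'cV[R]_n) s := S *m (invmx (Phi s) *m r s).
have dPhi' := deriv_on_restrict tau _ _ dPhiP.
have dJ S r : {within Iv tau, continuous r} -> deriv_on tau (J (pull S r)) (pull S r).
  move=> /subspace_continuousP cr; apply: hJ; apply/subspace_continuousP => t It.
  rewrite /pull; apply: (cvg_mulmx (fun=> S) _ _ _ (cvg_cst S)).
  apply: (cvg_mulmx _ _ _ _ _ (cr _ It)).
  apply: (cvg_invmx _ _ _ (deriv_on_cvg _ _ _ _ dPhi' It)).
  exact: uPhi (Iv_ge0 _ _ It).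
pose U := J \o pull Q; pose V := J \o pull (1%:M - Q).
(* [l r - V r t] plays the role of the improper integral over [[t, tau)]. *)
pose l r := limn (fun k => V r (u k)).
pose G r t := Phi t *m ((U r t - U r 0) + (V r t - l r)).
have Vl r : {within Iv tau, continuous r} ->
    (exists M, forall t, Iv tau t -> nrm (r t) <= M) -> V r (u k) @[k --> \oo] --> l r.
  move=> cr [M rM].
  exact: (unstable_cvg _ _ _ _ _ _ _ _ _ N0 lam0 dich2 (uPhi 0 (lexx 0)) (dJ _ _ cr) rM und Iu).
exists G => B; split.
- move=> r [cr bM].
  have dX := deriv_onD _ _ _ _ _ (deriv_onD _ _ _ _ _ (dJ Q r cr) (deriv_on_cst tau (- U r 0)))
    (deriv_onD _ _ _ _ _ (dJ (1%:M - Q) r cr) (deriv_on_cst tau (- l r))).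
  apply: deriv_on_eq (deriv_on_mulmx _ _ _ _ _ dPhi' dX) _ => t It.
  have t0 := Iv_ge0 _ _ It.
  (* The two complementary projections add up to 1, which leaves
     [Phi t *m (invmx (Phi t) *m r t)]. *)
  rewrite dPhiE // -mulmxA; congr (_ + _); rewrite !addr0 /pull -mulmxDl.
  by rewrite addrC subrK mul1mx mulKVmx // uPhi.
- move=> r M [cr bM] rM t It.
  exact: (dichotomy_bound _ _ _ _ _ _ _ _ _ _ _ _ N0 lam0 dich1 dich2 (dJ _ _ cr) (dJ _ _ cr)
    rM Iu ucof (Vl _ cr bM) It).
- move=> r1 r2 M [c1 b1] [c2 b2] rM t It.
  (* The choices made by [J] need not be additive, but a difference of antiderivatives is an
     antiderivative of the difference. *)
  have dB S : deriv_on tau (fun s => J (pull S r1) s - J (pull S r2) s)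
      (fun s => S *m (invmx (Phi s) *m (r1 s - r2 s))).
    apply: deriv_on_eq (deriv_onD _ _ _ _ _ (dJ S _ c1) (deriv_onN _ _ _ (dJ S _ c2))) _ => s Is.
    by rewrite /pull !mulmxBr.
  pose proof (cvgB (Vl _ c1 b1) (Vl _ c2 b2)) as Vl12.
  have := dichotomy_bound _ _ _ _ _ _ _ _ _ _ _ _ N0 lam0 dich1 dich2 (dB _) (dB _)
    rM Iu ucof Vl12 It.
  congr (nrm _ <= _); rewrite /G -mulmxBr; congr (_ *m _).
  by rewrite /U /V /=; apply/colP => i; rewrite !mxE; ring.
Qed.

End GreenOperator.

(** * Shadowing by a fixed point of the Green operator *)

Lemma within_continuous_superposition {R : realType} {n : nat} (tau : \bar R)
    (f : R -> 'cV[R]_n -> 'cV[R]_n) (x : R -> 'cV[R]_n) :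
  {within [set p : R * 'cV[R]_n | 0 <= p.1], continuous (fun p => f p.1 p.2)} ->
  {within Iv tau, continuous x} -> {within Iv tau, continuous (fun s => f s (x s))}.
Proof.
move=> /subspace_continuousP cf /subspace_continuousP cx.
apply/subspace_continuousP => t It.
have idt : s @[s --> within (Iv tau) (nbhs t)] --> t.
  by move=> P tP; apply: filterS tP => s.
pose proof (cvg_pair idt (cx t It)) as ct.
have ct' : (s, x s) @[s --> within (Iv tau) (nbhs t)] -->
    within [set p : R * 'cV[R]_n | 0 <= p.1] (nbhs (t, x t)).
  move=> P hP; apply: filterS2 (near_withinT (Iv tau) _) (ct _ hP) => s [s0 _].
  exact.
exact: cvg_comp ct' (cf (t, x t) (Iv_ge0 _ _ It)).
Qed.

Theorem theorem2 (R : realType) (n : nat) (nrm : 'cV[R]_n -> R)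
  (H : set 'cV[R]_n) (A : R -> 'M[R]_n) (f : R -> 'cV[R]_n -> 'cV[R]_n)
  (N lam delta L : R) :
  is_norm nrm ->
  H !=set0 ->
  {within [set t : R | 0 <= t], continuous A} ->
  {within [set p : R * 'cV[R]_n | 0 <= p.1], continuous (fun p => f p.1 p.2)} ->
  exp_dichotomy nrm A N lam ->
  0 < delta -> 0 < L ->
  (forall t x1 x2, 0 <= t -> nbhd_set nrm delta H x1 -> nbhd_set nrm delta H x2 ->
     nrm (f t x1 - f t x2) <= L * nrm (x1 - x2)) ->
  L < lam / (2 * N) ->
  cond_lip_shadowing nrm (fun t x => A t *m x + f t x) H.
Proof.
move=> nrmP _ cA cf dich delta0 L0 fL Llt; have [N0 [lam0 _]] := dich.
(* [kappa] solves [c * (L * kappa + 1) = kappa], which makes the ball of radius [kappa * eps]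
   invariant. *)
pose c := 2 * N / lam; pose q := c * L; pose kappa := c / (1 - q).
have c0 : 0 < c by rewrite divr_gt0 // mulr_gt0.
have q0 : 0 < q by rewrite mulr_gt0.
have q1 : q < 1.
  move: Llt; rewrite ltr_pdivlMr ?mulr_gt0 // /q /c => h.
  by rewrite mulrAC ltr_pdivrMr // mul1r mulrC.
have k0 : 0 < kappa by rewrite divr_gt0 // subr_gt0.
(* With this threshold [kappa * eps <= delta], so [y + z] stays where [f] is Lipschitz. *)
exists (delta / kappa), kappa; split; first exact: divr_gt0.
split=> //.
move=> eps eps0 epsd tau tau0 y dy [[yd /subspace_continuousP cdy] yeps] Hy.
pose rho := kappa * eps.
have rho0 : 0 < rho by rewrite mulr_gt0.
have rhod : rho <= delta by rewrite /rho mulrC -ler_pdivlMr.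
have [G [Gd Gb GL]] := dichotomy_operator nrmP _ _ _ _ dich tau0.
pose B r := {within Iv tau, continuous r} /\
  exists M, forall t, Iv tau t -> nrm (r t) <= M.
pose Z z := {within Iv tau, continuous z} /\ forall t, Iv tau t -> nrm (z t) <= rho.
pose r (z : R -> 'cV[R]_n) t := f t (y t + z t) + (A t *m y t - dy t).
have cy t : Iv tau t -> y s @[s --> within (Iv tau) (nbhs t)] --> y t.
  exact: (deriv_on_cvg _ _ _ _ yd).
have nb t : Iv tau t -> nbhd_set nrm delta H (y t).
  by move=> It; exists (y t); [exact: Hy|rewrite subrr (nrm0 nrmP) ltW].
have nbz z t : Z z -> Iv tau t -> nbhd_set nrm delta H (y t + z t).
  move=> Zz It; exists (y t); first exact: Hy.
  by rewrite addrC addKr (le_trans _ rhod) //; apply: Zz.2.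
have rM z t : Z z -> Iv tau t -> nrm (r z t) <= L * rho + eps.
  move=> Zz It; have t0 := Iv_ge0 _ _ It.
  (* A Lipschitz increment, at most [L * rho], minus the error of the pseudosolution, at most
     [eps]. *)
  have -> : r z t = (f t (y t + z t) - f t (y t)) - (dy t - (A t *m y t + f t (y t))).
    by apply/colP => i; rewrite !mxE; ring.
  rewrite (le_trans (ler_nrmD nrmP _ _)) // (nrmN nrmP) lerD ?yeps //.
  rewrite (le_trans (fL _ _ _ t0 (nbz _ _ Zz It) (nb _ It))) // ler_pM2l //.
  by rewrite addrC addKr; apply: Zz.2.
have Br z : Z z -> B (r z).
  move=> Zz; split; last by exists (L * rho + eps) => t; exact: rM.
  have /subspace_continuousP cz := Zz.1.
  have /subspace_continuousP cfz : {within Iv tau, continuous (fun s => f s (y s + z s))}.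
    apply: within_continuous_superposition => //; apply/subspace_continuousP => t It.
    exact: cvgD (cy t It) (cz t It).
  apply/subspace_continuousP => t It.
  have At : A s @[s --> within (Iv tau) (nbhs t)] --> A t.
    move/subspace_continuousP : cA => /(_ t (Iv_ge0 _ _ It)); apply: cvg_trans.
    by apply: cvg_app; apply: within_subset => s /Iv_ge0.
  exact: cvgD (cfz t It) (cvgB (cvg_mulmx _ _ _ _ At (cy t It)) (cdy t It)).
have [z Zz Gz] : exists2 z, Z z & forall t, Iv tau t -> G (r z) t = z t.
  apply: (contraction_fixpoint_within nrmP _ (fun z => G (r z)) _ q) => //.
  - exact: ltW.
  - exact: ltW.
  - move=> z Zz; split; first exact: (deriv_on_within _ _ _ (Gd _ (Br _ Zz))).
    move=> t It; rewrite (le_trans (Gb _ _ (Br _ Zz) (fun s => rM z s Zz) t It)) //.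
    rewrite /rho /kappa /q -/c le_eqVlt; apply/orP; left; apply/eqP; field.
    by rewrite gt_eqF // subr_gt0.
  - move=> z1 z2 M Z1 Z2 z12 t It; rewrite /q -mulrA.
    apply: (GL _ _ _ (Br _ Z1) (Br _ Z2)) => // s Is; rewrite /r opprD addrACA subrr addr0.
    rewrite (le_trans (fL _ _ _ (Iv_ge0 _ _ Is) (nbz _ _ Z1 Is) (nbz _ _ Z2 Is))) //.
    by rewrite ler_pM2l // opprD addrACA subrr add0r z12.
have dx := deriv_onD _ _ _ _ _ yd (Gd _ (Br _ Zz)).
(* [G (r z)] equals [z] on the interval and is the form whose derivative is known. *)
exists (fun t => y t + G (r z) t); split.
  exists (fun t => dy t + (A t *m G (r z) t + r z t)); split=> // t It.
  rewrite /r Gz //; apply/colP => i; rewrite mulmxDr !mxE; ring.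
by move=> t It; rewrite addrC addKr Gz //; apply: Zz.2.
Qed.
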